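(* The following hold: (i) $P_\ell(K_{2,n},3)=P(K_{2,n},3)$ whenever $2\leq n\leq 10$, and $P_\ell(K_{2,n},3)<P(K_{2,n},3)$ whenever $n\geq 12$; (ii) $P_\ell(K_{2,n},4)=P(K_{2,n},4)$ whenever $2\leq n\leq 24$, and $P_\ell(K_{2,n},4)<P(K_{2,n},4)$ whenever $n\geq 27$; (iii) $P_\ell(K_{2,n},5)=P(K_{2,n},5)$ whenever $2\leq n\leq 43$, and $P_\ell(K_{2,n},5)<P(K_{2,n},5)$ whenever $n\geq 44$.
   Context: A list assignment $L$ for a graph $G$ assigns to each vertex $v$ a set $L(v)$ of colors; it is an $m$-assignment if $|L(v)|=m$ for all $v$. $P(G,L)$ is the number of proper colorings $f$ of $G$ with $f(v)\in L(v)$ for all $v$. $P(G,m)$ is the chromatic polynomial of $G$; $P(K_{2,n},m)=m(m-1)^n+m(m-1)(m-2)^n$. The list color function $P_\ell(G,m)$ is the minimum of $P(G,L)$ over all $m$-assignments $L$ for $G$. *)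

(* Defs.v *)
From mathcomp Require Import all_boot finmap boolp.

Set Implicit Arguments.
Unset Strict Implicit.
Unset Printing Implicit Defensive.

Local Open Scope fset_scope.

Record sgraph := SGraph {
  vertex :> finType;
  adj : rel vertex;
  adj_sym : symmetric adj;
  adj_irrefl : irreflexive adj }.

Section CompleteBipartite.
Variables p q : nat.

Definition Kpq_adj (u v : 'I_p + 'I_q) : bool :=
  match u, v with
  | inl _, inr _ | inr _, inl _ => true
  | _, _ => false
  end.

Lemma Kpq_sym : symmetric Kpq_adj.
Proof. by case=> ? [?|?]. Qed.

Lemma Kpq_irrefl : irreflexive Kpq_adj.
Proof. by case. Qed.

Definition Kpq : sgraph := SGraph Kpq_sym Kpq_irrefl.

End CompleteBipartite.

Section Colorings.
Variable G : sgraph.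

Definition proper (C : eqType) (f : G -> C) : bool :=
  [forall u, forall v, adj u v ==> (f u != f v)].

(* Value at m of the chromatic polynomial. *)
Definition chrom_poly (m : nat) : nat := #|[set f : {ffun G -> 'I_m} | proper f]|.

(* Colors are natural numbers; G being finite, this is no restriction. *)
Definition list_assignment := G -> {fset nat}.

Definition is_assignment (m : nat) (L : list_assignment) : Prop :=
  forall v, #|` L v| = m.

(* The dependent function type over the finite types L v encodes the condition
   f v \in L v; properness compares the underlying colors. *)
Definition num_list_col (L : list_assignment) : nat :=
  #|[set f : {dffun forall v : G, L v} | proper (fun v => val (f v))]|.

Definition list_col_count (m : nat) : pred nat :=
  fun k => `[< exists2 L, is_assignment m L & num_list_col L = k >].

Lemma list_col_count_ex m : exists k, list_col_count m k.
Proof.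
exists (num_list_col (fun=> [fset x in iota 0 m])); apply/asboolP.
exists (fun=> [fset x in iota 0 m]) => // v.
by rewrite card_fseq undup_id ?iota_uniq ?size_iota.
Qed.

Definition list_color_fun (m : nat) : nat := ex_minn (list_col_count_ex m).

End Colorings.

Arguments is_assignment : clear implicits.
Arguments num_list_col : clear implicits.

(* Main.v *)
(* With A, B the lists of the two vertices of degree n and S_1, ..., S_n the other
   lists, the number of list colorings is
     sum over (a, b) in A x B of prod_i |S_i \ {a, b}|.
   Put k = |A :&: B|.  For k = m every term is at least the corresponding term of
   the chromatic polynomial.  For k = m - 1 this is still true once the m - 1
   diagonal terms are combined, by Bernoulli's inequality, with the term of the two
   private colors.  For k <= m - 2, weighted AM-GM bounds the sum below by a product
   over i of quantities that depend only on how many common and private colors S_i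
   contains; for fixed weights it remains to check finitely many numerical
   inequalities, which is done with rounded binary floating-point numbers.

   For the strict inequalities take k = m - 2 and distribute the lists
   (A :&: B) :|: {a', b'} (a', b' private colors of A, B) evenly.  The count is then at
   most m (m - 1)^n for the least n claimed, and each further vertex with list A
   multiplies it by at most m - 1. *)

From Stdlib Require Import PArith NArith.
Require Import Defs.
From mathcomp Require Import all_boot.
From mathcomp Require Import all_order all_algebra finmap boolp zify.

Set Implicit Arguments.
Unset Strict Implicit.
Unset Printing Implicit Defensive.

(** * Weighted AM-GM *)

Section WeightedAGM.
Import Order.TTheory GRing.Theory Num.Theory.
Local Open Scope ring_scope.

Lemma seq_AGM (R : numFieldType) (s : seq R) :
  (forall x, x \in s -> 0 <= x) ->
  \prod_(x <- s) (x *+ size s) <= (\sum_(x <- s) x) ^+ size s.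
Proof.
move=> s_ge0; rewrite !(big_tnth _ _ s) /=.
have E_ge0 : {in predT, forall i : 'I_(size s),
    0 <= tnth (in_tuple s) i *+ #|'I_(size s)|}.
  by move=> i _; rewrite mulrn_wge0 // s_ge0 // mem_tnth.
by case: (leif_AGM_scaled E_ge0) => + _; rewrite cardT size_enum_ord.
Qed.

(** AM-GM for the sequence that repeats E i / w i exactly w i times, with denominators cleared. *)
Lemma weighted_AGM (I : Type) (r : seq I) (E w : I -> nat)
    (D := (\sum_(i <- r) w i)%N) :
  (D ^ D * \prod_(i <- r) E i ^ w i <=
   (\sum_(i <- r) E i) ^ D * \prod_(i <- r) w i ^ w i)%N.
Proof.
pose x i : rat := (E i)%:R / (w i)%:R.
have x_ge0 i : 0 <= x i by rewrite divr_ge0 ?ler0n.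
pose s := flatten [seq nseq (w i) (x i) | i <- r].
have sz : size s = D.
  rewrite size_flatten sumnE /shape -map_comp big_map.
  by apply: eq_bigr => i _; rewrite /= size_nseq.
have s_ge0 y : y \in s -> 0 <= y.
  rewrite /s; elim: (r) => //= i r' IH; rewrite mem_cat => /orP[|]; last exact: IH.
  by rewrite mem_nseq => /andP[_ /eqP ->].
have sums : \sum_(y <- s) y = \sum_(i <- r) x i *+ w i.
  rewrite big_flatten big_map; apply: eq_bigr => i _.
  by rewrite big_nseq; elim: (w i) => //= k ->; rewrite mulrS.
have prods : \prod_(y <- s) (y *+ D) = \prod_(i <- r) (x i *+ D) ^+ w i.
  rewrite big_flatten big_map; apply: eq_bigr => i _.
  by rewrite big_nseq; elim: (w i) => //= k ->; rewrite exprS.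
have sum_ge0 : 0 <= \sum_(y <- s) y by rewrite big_seq sumr_ge0.
(* Only an inequality: an index of weight 0 has no copy in [s], but its E i stays in the sum on the
   right. *)
have sum_le : \sum_(y <- s) y <= \sum_(i <- r) (E i)%:R.
  rewrite sums; apply: ler_sum => i _.
  case: (posnP (w i)) => [-> | wi]; first by rewrite mulr0n.
  by rewrite -[X in X <= _]mulr_natr /x mulfVK // pnatr_eq0 -lt0n.
rewrite -(ler_nat rat) !natrM !natrX !natr_prod natr_sum.
under eq_bigr do rewrite natrX; under [X in _ <= _ * X]eq_bigr do rewrite natrX.
apply: le_trans (_ : (\sum_(y <- s) y) ^+ D * \prod_(i <- r) (w i)%:R ^+ w i <= _);
  last first.
  apply: ler_wpM2r; first by apply: prodr_ge0 => i _; exact: exprn_ge0.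
  by apply: lerXn2r; rewrite ?nnegrE // sumr_ge0.
apply: le_trans (ler_wpM2r _ (_ : \prod_(y <- s) (y *+ D) <= _)); last 2 first.
- by apply: prodr_ge0 => i _; exact: exprn_ge0.
- by rewrite -sz seq_AGM.
rewrite prods [X in D%:R ^+ X](erefl : D = \sum_(i <- r) w i)%N -prodrXr -!big_split /=.
rewrite le_eqVlt; apply/orP; left; apply/eqP/eq_bigr => i _.
case: (posnP (w i)) => [-> | wi]; first by rewrite !expr0 !mulr1.
by rewrite -!exprMn -[x i *+ D]mulr_natr /x mulrAC mulfVK ?pnatr_eq0 -?lt0n // mulrC.
Qed.
End WeightedAGM.

(** * Counting list colorings of K_{2,n} *)

(** Once the two vertices of degree n have colors a and b, the others are colored independently. The
    injections [h] make the count apply to list colorings and to ordinary colorings alike. *)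
Lemma card_proper_Kpq n (T : Kpq 2 n -> finType) (C : eqType)
    (h : forall v, T v -> C) :
  (forall v, injective (@h v)) ->
  #|[set f : {dffun forall v, T v} | @Defs.proper (Kpq 2 n) C (fun v => h v (f v))]| =
  \sum_(a : T (inl ord0)) \sum_(b : T (inl (lift ord0 ord0))) \prod_(i < n)
     #|[pred c : T (inr i) | (h _ c != h _ a) && (h _ c != h _ b)]|.
Proof.
move=> hinj; set u := inl ord0; set v := inl _.
rewrite -sum1_card (partition_big (fun f : {dffun forall v, T v} => (f u, f v)) predT) //=.
rewrite pair_bigA /=; apply: eq_bigr => -[a b] _ /=.
pose F (x : Kpq 2 n) : pred (T x) := match x with
  | inl i => fun c => if i == ord0 then h _ c == h _ a else h _ c == h _ b
  | inr i => fun c => (h _ c != h _ a) && (h _ c != h _ b) end.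
transitivity #|(family F : simpl_pred {dffun forall v, T v})|; last first.
  rewrite card_family foldrE big_map big_enum /= big_sumType /= big_ord_recl big_ord1 /=.
  rewrite (@eq_card1 _ a) 1?(@eq_card1 _ b) ?mul1n //.
    by move=> c; rewrite !inE /=; exact: (inj_eq (@hinj v)).
  by move=> c; rewrite !inE /=; exact: (inj_eq (@hinj u)).
rewrite sum1_card; apply: eq_card => f; rewrite unfold_in /= !inE /=.
apply/andP/forallP => [[/forallP fP /eqP[fa fb]] x | fF].
  case: x => i; rewrite unfold_in /=.
    case: eqP => [-> | ]; first by rewrite -fa.
    case: i => -[|[|//]] Hi ne; first by case: ne; apply: val_inj.
    rewrite -fb /v.
    by have -> : Ordinal Hi = lift ord0 ord0 by apply: val_inj.
  have /forallP/(_ u) := fP (inr i); have /forallP/(_ v) := fP (inr i).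
  by rewrite /= fa fb => -> ->.
have fa : f u = a by apply: (hinj u); apply/eqP; have := fF u; rewrite unfold_in.
have fb : f v = b by apply: (hinj v); apply/eqP; have := fF v; rewrite unfold_in.
split; last by rewrite fa fb.
have main (i : 'I_2) (j : 'I_n) : h _ (f (inr j)) != h _ (f (inl i)).
  have := fF (inr j); rewrite unfold_in /= -fa -fb => /andP[h0 h1].
  case: i => -[|[|//]] Hi.
    by have -> : Ordinal Hi = ord0 by apply: val_inj.
  by have -> : Ordinal Hi = lift ord0 ord0 by apply: val_inj.
apply/forallP => x; apply/forallP => y; apply/implyP.
by case: x y => [i|i] [j|j] //= _; rewrite ?main // eq_sym main.
Qed.

(** Lists are now sequences: [ext] counts the extensions of the colors a, b of the two vertices of
    degree n to all others, [ncol] all list colorings. *)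
Definition avail (a b : nat) (S : seq nat) := count [pred c | (c != a) && (c != b)] S.
Definition ext (ls : seq (seq nat)) a b := \prod_(S <- ls) avail a b S.
Definition ncol (A B : seq nat) ls := \sum_(a <- A) \sum_(b <- B) ext ls a b.

Lemma num_list_colE n (L : list_assignment (Kpq 2 n)) :
  num_list_col (Kpq 2 n) L =
  ncol (L (inl ord0)) (L (inl (lift ord0 ord0)))
       [seq (L (inr i) : seq nat) | i <- enum 'I_n].
Proof.
rewrite /num_list_col (card_proper_Kpq (h := fun v => val)); last by move=> v; exact: val_inj.
rewrite /ncol big_seq_fsetE /=; apply: eq_bigr => a _.
rewrite big_seq_fsetE /=; apply: eq_bigr => b _.
rewrite /ext big_map big_enum /=; apply: eq_bigr => i _.
by rewrite /avail -sum1_count -sum1_card big_seq_fsetE.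
Qed.

Lemma chrom_poly_Kpq n m :
  chrom_poly (Kpq 2 n) m = ncol (iota 0 m) (iota 0 m) (nseq n (iota 0 m)).
Proof.
have -> : chrom_poly (Kpq 2 n) m = _ :=
  @card_proper_Kpq n (fun _ => 'I_m) 'I_m (fun _ => id) (fun _ => @inj_id _).
have iotaE (P : pred nat) (F : nat -> nat) :
    \sum_(i <- iota 0 m | P i) F i = \sum_(i < m | P i) F i.
  by rewrite -big_mkord /index_iota subn0.
rewrite /ncol iotaE; apply: eq_bigr => a _; rewrite iotaE; apply: eq_bigr => b _.
rewrite /ext big_nseq -big_const_ord; apply: eq_bigr => i _.
by rewrite /avail -sum1_count iotaE -sum1_card.
Qed.

Lemma avail_eq a S : uniq S -> avail a a S = size S - (a \in S).
Proof.
move=> uS; rewrite -count_uniq_mem // -(count_predC (pred1 a) S) addKn.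
by apply: eq_count => c /=; rewrite andbb.
Qed.

Lemma avail_neq a b S : uniq S -> a != b ->
  avail a b S = size S - (a \in S) - (b \in S).
Proof.
move=> uS ab; rewrite -!count_uniq_mem // -(count_predC (predU (pred1 a) (pred1 b)) S).
have := count_predUI (pred1 a) (pred1 b) S.
rewrite [count (predI _ _) _](_ : _ = 0) ?addn0 => [->|].
  by rewrite -subnDA addKn; apply: eq_count => c /=; rewrite negb_or.
apply/eqP; rewrite -leqn0 leqNgt -has_count; apply/hasPn => c _ /=.
by apply: contra ab => /andP[/eqP <- /eqP <-].
Qed.

Lemma ext_nseq n A a b : ext (nseq n A) a b = avail a b A ^ n.
Proof. by rewrite /ext big_nseq iter_muln_1. Qed.

Lemma sum_const_seq (T : Type) (s : seq T) (c : nat) : \sum_(i <- s) c = size s * c.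
Proof. by rewrite big_const_seq count_predT iter_addn_0 mulnC. Qed.

Lemma ncol_nseq n m A : uniq A -> size A = m ->
  ncol A A (nseq n A) = m * (m - 1) ^ n + m * (m - 1) * (m - 2) ^ n.
Proof.
move=> uA sA; rewrite /ncol -mulnA -mulnDr -[X in X * _]sA -sum_const_seq.
apply: eq_big_seq => a aA; rewrite (big_rem a) //= ext_nseq avail_eq // aA sA.
congr (_ + _); transitivity (\sum_(b <- rem a A) (m - 2) ^ n).
  apply: eq_big_seq => b; rewrite mem_rem_uniq // !inE => /andP[ba bA].
  by rewrite ext_nseq avail_neq 1?eq_sym // aA bA sA -subnDA.
by rewrite sum_const_seq size_rem // sA subn1.
Qed.

Lemma chrom_poly_Kpq2 n m :
  chrom_poly (Kpq 2 n) m = m * (m - 1) ^ n + m * (m - 1) * (m - 2) ^ n.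
Proof. by rewrite chrom_poly_Kpq (@ncol_nseq _ m) ?iota_uniq ?size_iota. Qed.

(** * From the list color function to bounds on [ncol] *)

Lemma list_color_fun_le n m (A B : {fset nat}) (S : 'I_n -> {fset nat}) :
  #|` A| = m -> #|` B| = m -> (forall i, #|` S i| = m) ->
  list_color_fun (Kpq 2 n) m <= ncol A B [seq (S i : seq nat) | i <- enum 'I_n].
Proof.
move=> cA cB cS; rewrite /list_color_fun; case: ex_minnP => k _; apply.
apply/asboolP; exists (fun v => match v with
  | inl i => if i == ord0 then A else B | inr i => S i end).
  by case=> i //=; case: ifP.
by rewrite num_list_colE.
Qed.

(** For explicit assignments. A finite set may enumerate its elements in another order, so the sums
    are compared up to permutation. *)
Lemma list_color_fun_lt n m (A B : seq nat) (ls : seq (seq nat)) K :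
  uniq A -> uniq B -> all uniq ls -> size A = m -> size B = m ->
  all (fun S => size S == m) ls -> size ls = n ->
  ncol A B ls < K -> list_color_fun (Kpq 2 n) m < K.
Proof.
move=> uA uB uls sA sB sls sz; apply: leq_ltn_trans.
have cf (s : seq nat) : uniq s -> size s = m -> #|` [fset x in s]%fset| = m.
  by move=> us <-; rewrite card_fseq undup_id.
have sN i : i < n -> uniq (nth [::] ls i) /\ size (nth [::] ls i) = m.
  by rewrite -sz => lt; split; [apply: (allP uls) | apply/eqP/(allP sls)];
    rewrite mem_nth.
pose S (i : 'I_n) : {fset nat} := [fset x in nth [::] ls i]%fset.
apply: leq_trans (list_color_fun_le (cf _ uA sA) (cf _ uB sB) (S := S) _) _.
  by move=> i; have [] := sN i (ltn_ord i); exact: cf.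
have pf (s : seq nat) : uniq s -> perm_eq (enum_fset [fset x in s]%fset) s.
  move=> us; apply: uniq_perm => //.
  by move=> x; rewrite -[LHS]/(x \in [fset y in s]%fset) inE.
rewrite /ncol (perm_big _ (pf _ uA)) /=; apply: leq_sum => a _.
rewrite (perm_big _ (pf _ uB)) /=; apply: leq_sum => b _.
rewrite /ext big_map big_enum /= (big_nth [::]) sz big_mkord.
apply: leq_prod => i _; rewrite leq_eqVlt; apply/orP; left; apply/eqP.
by have [/pf/permP eqc _] := sN i (ltn_ord i); exact: eqc.
Qed.

(** Equal lists attain the chromatic value, so only a lower bound over all assignments is left. *)
Lemma list_color_fun_eq n m :
  (forall A B ls, uniq A -> uniq B -> all uniq ls -> size A = m -> size B = m ->
     all (fun S => size S == m) ls -> size ls = n ->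
     m * (m - 1) ^ n + m * (m - 1) * (m - 2) ^ n <= ncol A B ls) ->
  list_color_fun (Kpq 2 n) m = chrom_poly (Kpq 2 n) m.
Proof.
rewrite chrom_poly_Kpq2 => H; apply/eqP; rewrite eqn_leq; apply/andP; split.
  rewrite -ltnS; apply: (@list_color_fun_lt _ _ (iota 0 m) (iota 0 m) (nseq n (iota 0 m)));
    rewrite ?iota_uniq ?size_iota ?size_nseq ?all_nseq ?iota_uniq ?size_iota ?eqxx ?orbT //.
  by rewrite ltnS (@ncol_nseq _ m) ?iota_uniq ?size_iota.
rewrite /list_color_fun; case: ex_minnP => k /asboolP[L Lm <-] _; rewrite num_list_colE.
apply: H; [exact: fset_uniq | exact: fset_uniq | | exact: Lm | exact: Lm | |].
- by apply/allP => _ /mapP[i _ ->]; exact: fset_uniq.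
- by apply/allP => _ /mapP[i _ ->]; apply/eqP; exact: Lm.
- by rewrite size_map size_enum_ord.
Qed.

(** * Lower bounds *)

(** C consists of the common colors, A' and B' of the private ones. *)
Lemma split_common m (A B : seq nat) : uniq A -> uniq B -> size A = m -> size B = m ->
  exists C A' B', [/\ uniq (C ++ A' ++ B'), perm_eq A (C ++ A'), perm_eq B (C ++ B'),
    size A' = m - size C & size B' = m - size C].
Proof.
move=> uA uB sA sB; pose C := [seq a <- A | a \in B].
exists C, [seq a <- A | a \notin B], [seq b <- B | b \notin A].
have pA : perm_eq A (C ++ [seq a <- A | a \notin B]) by rewrite perm_sym perm_filterC.
have pB : perm_eq B (C ++ [seq b <- B | b \notin A]).
  rewrite perm_sym; have := perm_filterC (mem A) B; move/permPl; apply: perm_trans.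
  rewrite perm_cat2r.
  apply: uniq_perm; rewrite ?filter_uniq // => x.
  by rewrite !mem_filter andbC.
split=> //.
- rewrite catA cat_uniq -(perm_uniq pA) uA filter_uniq // andbT -all_predC.
  by apply/allP => x; rewrite mem_filter => /andP[xA _] /=; rewrite -(perm_mem pA).
- by rewrite -sA (perm_size pA) size_cat addKn.
- by rewrite -sB (perm_size pB) size_cat addKn.
Qed.

Lemma perm_ncol A A' B B' ls : perm_eq A A' -> perm_eq B B' -> ncol A B ls = ncol A' B' ls.
Proof.
move=> pA pB; rewrite /ncol (perm_big _ pA) /=; apply: eq_bigr => a _.
by rewrite (perm_big _ pB).
Qed.

(** Bernoulli: the product of the 1 + d x / p is at least 1 + (sum of the d x) / p, here multiplied
    by p ^ (size s + 1). *)
Lemma bernoulli (T : Type) (s : seq T) (d : T -> bool) p :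
  p ^ size s * (p + \sum_(x <- s) d x) <= p * \prod_(x <- s) (p + d x).
Proof.
elim: s => [|x s IH]; first by rewrite !big_nil /= addn0 muln1 mul1n.
rewrite !big_cons /= expnS [p * (_ * _)]mulnCA.
apply: leq_trans (leq_mul (leqnn (p + d x)) IH).
rewrite -mulnA mulnCA [X in _ <= X]mulnCA leq_mul2l; apply/orP; right.
by case: (d x); nia.
Qed.

(** The same for 1 - d x / p; truncation makes the left side 0 once the sum exceeds p. *)
Lemma bernoulli_sub (T : Type) (s : seq T) (d : T -> bool) p :
  p ^ size s * (p - \sum_(x <- s) d x) <= p * \prod_(x <- s) (p - d x).
Proof.
elim: s => [|x s IH]; first by rewrite !big_nil /= subn0 muln1 mul1n.
rewrite !big_cons /= expnS [p * (_ * _)]mulnCA.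
apply: leq_trans (leq_mul (leqnn (p - d x)) IH).
rewrite -mulnA mulnCA [X in _ <= X]mulnCA leq_mul2l; apply/orP; right.
by case: (d x); nia.
Qed.

(* The product of |S \ {a, b}| over (a, b) in a rectangle of s * t pairs of distinct
   colors when S contains x of the s rows and y of the t columns. *)
Definition rect_value m s t x y :=
  ((m - 2) ^ y * (m - 1) ^ (t - y)) ^ x * ((m - 1) ^ y * m ^ (t - y)) ^ (s - x).

(* S contains x of the k common colors, y of the l colors private to A and z of the
   l colors private to B. *)
Definition list_value m k l p0 p2 p3 x y z :=
  ((m - 1) ^ x * m ^ (k - x)) ^ p0 * rect_value m k l x z ^ p2 *
  rect_value m l k y x ^ p2 * rect_value m l l y z ^ p3.

Lemma prod_expn (T : Type) (s : seq T) (F : T -> nat) n :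
  \prod_(i <- s) F i ^ n = (\prod_(i <- s) F i) ^ n.
Proof. by rewrite (big_morph (fun x => x ^ n) (fun x y => expnMn x y n) (exp1n n)). Qed.

Lemma prod_const_seq (T : Type) (s : seq T) (c : nat) : \prod_(i <- s) c = c ^ size s.
Proof. by rewrite big_const_seq count_predT iter_muln_1. Qed.

Lemma prod_mem (S s : seq nat) (u v : nat) :
  \prod_(a <- s) (if a \in S then u else v) =
  u ^ count (mem S) s * v ^ (size s - count (mem S) s).
Proof.
rewrite -(count_predC (mem S) s) addKn; elim: s => [|a s IH]; first by rewrite big_nil.
rewrite big_cons IH -[count (mem S) (a :: s)]/((a \in S) + count (mem S) s)
  -[count (predC _) (a :: s)]/((a \notin S) + count (predC (mem S)) s) !expnD.
case: (a \in S); rewrite /= ?expn1 ?expn0 ?mul1n; first by rewrite mulnA.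
by rewrite mulnCA.
Qed.

Lemma prod_avail_diag m (S s : seq nat) : uniq S -> size S = m ->
  \prod_(a <- s) avail a a S = (m - 1) ^ count (mem S) s * m ^ (size s - count (mem S) s).
Proof.
move=> uS sS; rewrite -prod_mem; apply: eq_bigr => a _.
by rewrite avail_eq // sS; case: (a \in S); rewrite ?subn0.
Qed.

Lemma prod_avail_rect m (S s t : seq nat) : uniq S -> size S = m ->
  {in s & t, forall a b, a != b} ->
  \prod_(a <- s) \prod_(b <- t) avail a b S =
  rect_value m (size s) (size t) (count (mem S) s) (count (mem S) t).
Proof.
move=> uS sS st; rewrite /rect_value -!prod_mem.
apply: eq_big_seq => a aS.
case: (boolP (a \in S)) => aS'; apply: eq_big_seq => b bt; rewrite avail_neq ?st // sS.
  by rewrite aS'; case: (b \in S); rewrite ?subn0 -?subnDA.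
by rewrite (negbTE aS') subn0; case: (b \in S); rewrite ?subn0.
Qed.

(** * Lower bounds on [ncol] according to the number of common colors *)

Section LowerBound.
Variables (m : nat) (C A' B' : seq nat) (ls : seq (seq nat)).
Hypothesis uCAB : uniq (C ++ A' ++ B').
Hypothesis uls : all uniq ls.
Hypothesis sls : all (fun S => size S == m) ls.
Let k := size C.

Let neq_CA a b : a \in C -> b \in A' -> a != b.
Proof.
move=> aC bA; move: uCAB; rewrite cat_uniq => /and3P[_ /hasPn/(_ b) + _].
by rewrite mem_cat bA => /(_ isT); apply: contra => /eqP <-.
Qed.

Let neq_CB a b : a \in C -> b \in B' -> a != b.
Proof.
move=> aC bB; move: uCAB; rewrite cat_uniq => /and3P[_ /hasPn/(_ b) + _].
by rewrite mem_cat bB orbT => /(_ isT); apply: contra => /eqP <-.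
Qed.

Let neq_AB a b : a \in A' -> b \in B' -> a != b.
Proof.
move=> aA bB; move: uCAB; rewrite !cat_uniq => /and4P[_ _ _ /andP[/hasPn/(_ b bB) + _]].
by apply: contra => /eqP <-.
Qed.

(** The blocks are bounded differently: equal common colors, distinct common colors, two mixed
    blocks, private colors. *)
Lemma ncol_split : ncol (C ++ A') (C ++ B') ls =
  \sum_(a <- C) ext ls a a + \sum_(a <- C) \sum_(b <- rem a C) ext ls a b +
  \sum_(a <- C) \sum_(b <- B') ext ls a b + \sum_(a <- A') \sum_(b <- C) ext ls a b +
  \sum_(a <- A') \sum_(b <- B') ext ls a b.
Proof.
rewrite /ncol big_cat /=.
under eq_bigr do rewrite big_cat /=.
under [X in _ + X]eq_bigr do rewrite big_cat /=.
rewrite !big_split /= !addnA; do 3 congr (_ + _).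
rewrite -big_split /=; apply: eq_big_seq => a aC.
by rewrite (big_rem a aC).
Qed.

Lemma ext_ge a b : (m - 2) ^ size ls <= ext ls a b.
Proof.
rewrite /ext; elim: ls uls sls => [|S s IH] /=; first by rewrite big_nil.
move=> /andP[uS us] /andP[/eqP sS ss]; rewrite big_cons expnS leq_mul ?IH //.
have [->|ab] := eqVneq a b; first by rewrite avail_eq // sS; lia.
by rewrite avail_neq // sS; lia.
Qed.

Lemma inner_ge : k * (k - 1) * (m - 2) ^ size ls <=
  \sum_(a <- C) \sum_(b <- rem a C) ext ls a b.
Proof.
rewrite -mulnA -sum_const_seq big_seq [X in _ <= X]big_seq; apply: leq_sum => a aC.
rewrite -[k - 1]/(size C - 1) subn1 -(size_rem aC) -sum_const_seq.
by apply: leq_sum => b _; exact: ext_ge.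
Qed.

Lemma rect_ge (s t : seq nat) :
  size s * size t * (m - 2) ^ size ls <= \sum_(a <- s) \sum_(b <- t) ext ls a b.
Proof.
rewrite -mulnA -sum_const_seq; apply: leq_sum => a _.
by rewrite -sum_const_seq; apply: leq_sum => b _; exact: ext_ge.
Qed.

Lemma ncol_ge_same : size C = m ->
  m * (m - 1) ^ size ls + m * (m - 1) * (m - 2) ^ size ls <= ncol (C ++ A') (C ++ B') ls.
Proof.
move=> sC; rewrite ncol_split; do 3 (apply: (leq_trans _ (leq_addr _ _))).
apply: leq_add; last by have := inner_ge; rewrite /k sC.
rewrite -[X in X * _]sC.
rewrite -sum_const_seq; apply: leq_sum => a _.
rewrite /ext; elim: ls uls sls => [|S s IH] /=; first by rewrite big_nil.
move=> /andP[uS us] /andP[/eqP sS ss]; rewrite big_cons expnS leq_mul ?IH //.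
by rewrite avail_eq // sS; lia.
Qed.

(* A list containing both private colors misses a common one; by Bernoulli the
   gain on the diagonal then pays for the loss on the pair of private colors. *)
Lemma ncol_ge_pred a0 b0 : size C = m - 1 -> 1 < m -> A' = [:: a0] -> B' = [:: b0] ->
  m * (m - 1) ^ size ls + m * (m - 1) * (m - 2) ^ size ls <= ncol (C ++ A') (C ++ B') ls.
Proof.
move=> sC m1 eA eB.
(* [d] marks the lists that miss c, [e] those that contain both private colors. *)
pose d c (S : seq nat) := c \notin S; pose e (S : seq nat) := (a0 \in S) && (b0 \in S).
have diag c : \prod_(S <- ls) (m - 1 + d c S) = ext ls c c.
  apply: eq_big_seq => S Sls; rewrite avail_eq ?(allP uls) // (eqP (allP sls _ Sls)) /d.
  by case: (c \in S) => /=; lia.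
have off : \prod_(S <- ls) (m - 1 - e S) <= ext ls a0 b0.
  rewrite /ext big_seq [X in _ <= X]big_seq; apply: leq_prod => S Sls.
  rewrite avail_neq ?(allP uls) ?neq_AB ?eA ?eB ?inE // (eqP (allP sls _ Sls)) /e.
  by case: (a0 \in S); case: (b0 \in S) => /=; lia.
have ed : \sum_(S <- ls) e S <= \sum_(c <- C) \sum_(S <- ls) d c S.
  rewrite exchange_big /= big_seq [X in _ <= X]big_seq; apply: leq_sum => S Sls.
  case eS: (e S) => //; move/andP: eS => [aS bS].
  have [CS|/allPn[c cC cS]] := boolP (all (mem S) C); last first.
    by rewrite (big_rem c) //= /d cS.
  (* Here S, of size m, would contain m + 1 colors: all common ones and both private ones. *)
  have := uniq_leq_size uCAB (s2 := S); rewrite !size_cat eA eB /= sC (eqP (allP sls _ Sls)).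
  have sub : {subset C ++ [:: a0; b0] <= S}.
    by move=> x; rewrite mem_cat !inE => /orP[/(allP CS) // | /orP[] /eqP -> //].
  by move=> /(_ sub); lia.
have mainge : m * (m - 1) ^ size ls <= \sum_(a <- C) ext ls a a + ext ls a0 b0.
  (* The factor m - 1 is the p of both Bernoulli inequalities. *)
  rewrite -(leq_pmul2l (m := m - 1)); last by lia.
  rewrite mulnDr big_distrr /=.
  have h1 : \sum_(c <- C) (m - 1) ^ size ls * (m - 1 + \sum_(S <- ls) d c S) <=
      \sum_(c <- C) (m - 1) * ext ls c c.
    by apply: leq_sum => c _; rewrite -diag; exact: bernoulli.
  have h2 := leq_trans (bernoulli_sub ls e (m - 1)) (leq_mul (leqnn _) off).
  (* By [ed] the gain covers the loss: (m - 1)^2 + sum of d + (m - 1 - sum of e) is at least m (m -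
     1). *)
  apply: leq_trans (leq_add h1 h2).
  rewrite -big_distrr -mulnDr big_split sum_const_seq /= sC.
  by rewrite mulnA mulnC leq_mul2l; apply/orP; right; nia.
rewrite ncol_split.
(* The other blocks have (m - 1)(m - 2) + 2 (m - 1) = m (m - 1) terms, each at least (m - 2)^n. *)
have := inner_ge; rewrite /k sC; have := rect_ge C B'; have := rect_ge A' C.
rewrite [X in _ -> _ -> _ -> _ <= _ + X](_ : _ = ext ls a0 b0); last by rewrite eA eB !big_seq1.
rewrite eA eB /= sC; move: mainge; nia.
Qed.

(* Off-diagonal pairs of common colors get no weight: their terms are bounded by
   (m - 2)^n separately. *)
Lemma ncol_ge_AGM l p0 p2 p3 K Q :
  let D := k * p0 + k * l * p2 + l * k * p2 + l * l * p3 in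
  size A' = l -> size B' = l -> 0 < D ->
  (forall x y z, x <= k -> y <= l -> z <= l -> x + y + z <= m ->
     K <= list_value m k l p0 p2 p3 x y z) ->
  (p0 ^ p0) ^ k * (p2 ^ p2) ^ (k * l) * (p2 ^ p2) ^ (l * k) * (p3 ^ p3) ^ (l * l) * Q ^ D <=
    D ^ D * K ^ size ls ->
  Q + k * (k - 1) * (m - 2) ^ size ls <= ncol (C ++ A') (C ++ B') ls.
Proof.
move=> D sA sB D0 HK HQ.
(* Each pair of colors is listed together with its weight. *)
pose r := [seq (p0, (a, a)) | a <- C] ++ [seq (p2, (a, b)) | a <- C, b <- B'] ++
  [seq (p2, (a, b)) | a <- A', b <- C] ++ [seq (p3, (a, b)) | a <- A', b <- B'].
pose w (i : nat * (nat * nat)) := i.1.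
have sum_r (F : nat * (nat * nat) -> nat) : \sum_(i <- r) F i =
    \sum_(a <- C) F (p0, (a, a)) +
    (\sum_(a <- C) \sum_(b <- B') F (p2, (a, b)) +
    (\sum_(a <- A') \sum_(b <- C) F (p2, (a, b)) +
     \sum_(a <- A') \sum_(b <- B') F (p3, (a, b)))).
  by rewrite /r !big_cat /= big_map !big_allpairs_dep.
have prod_r (F : nat * (nat * nat) -> nat) : \prod_(i <- r) F i =
    \prod_(a <- C) F (p0, (a, a)) *
    (\prod_(a <- C) \prod_(b <- B') F (p2, (a, b)) *
    (\prod_(a <- A') \prod_(b <- C) F (p2, (a, b)) *
     \prod_(a <- A') \prod_(b <- B') F (p3, (a, b)))).
  by rewrite /r !big_cat /= big_map !big_allpairs_dep.
pose S' := \sum_(i <- r) ext ls i.2.1 i.2.2.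
have S'E : S' + k * (k - 1) * (m - 2) ^ size ls <= ncol (C ++ A') (C ++ B') ls.
  rewrite ncol_split /S' sum_r /=; apply: leq_trans (leq_add (leqnn _) inner_ge) _.
  set I := (X in _ + X <= _); rewrite -!addnA leq_add2l [I + _]addnC !addnA leqnn //.
have const_rect s t c : \sum_(a <- s) \sum_(b <- t) c = size s * size t * c :> nat.
  by under eq_bigr do rewrite sum_const_seq; rewrite sum_const_seq mulnA.
have rect_prod (s t : seq nat) c : \prod_(a <- s) \prod_(b <- t) c = c ^ (size s * size t).
  by under eq_bigr do rewrite prod_const_seq; rewrite prod_const_seq -expnM mulnC.
have := weighted_AGM r (fun i => ext ls i.2.1 i.2.2) w.
rewrite (_ : \sum_(i <- r) w i = D); last first.
  by rewrite sum_r //= sum_const_seq !const_rect sA sB !addnA.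
rewrite (_ : \prod_(i <- r) w i ^ w i = (p0 ^ p0) ^ k * (p2 ^ p2) ^ (k * l) *
    (p2 ^ p2) ^ (l * k) * (p3 ^ p3) ^ (l * l)); last first.
  by rewrite prod_r //= prod_const_seq !rect_prod sA sB !mulnA.
rewrite -/S'; pose W := (p0 ^ p0) ^ k * (p2 ^ p2) ^ (k * l) *
    (p2 ^ p2) ^ (l * k) * (p3 ^ p3) ^ (l * l).
rewrite -/W => AG; rewrite -/W in HQ.
have KE : K ^ size ls <= \prod_(i <- r) ext ls i.2.1 i.2.2 ^ w i.
  rewrite -prod_const_seq; under [X in _ <= X]eq_bigr do rewrite /ext -prod_expn.
  (* After the exchange each list S contributes a factor of its own, a [list_value], which is at
     least K. *)
  rewrite exchange_big /= big_seq [X in _ <= X]big_seq; apply: leq_prod => S Sls.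
  have uS := allP uls _ Sls; have sS := eqP (allP sls _ Sls).
  apply: leq_trans (HK (count (mem S) C) (count (mem S) A') (count (mem S) B') _ _ _ _) _.
  - exact: count_size.
  - by rewrite -sA count_size.
  - by rewrite -sB count_size.
  (* Common and private colors are distinct, so S contains at most m of them. *)
  - rewrite -addnA -!count_cat -sS -size_filter uniq_leq_size ?filter_uniq // => x.
    by rewrite mem_filter => /andP[].
  rewrite prod_r //= /list_value -!mulnA.
  under [X in _ <= _ * (X * _)]eq_bigr do rewrite prod_expn.
  under [X in _ <= _ * (_ * (X * _))]eq_bigr do rewrite prod_expn.
  under [X in _ <= _ * (_ * (_ * X))]eq_bigr do rewrite prod_expn.
  have CB : {in C & B', forall a b, a != b} by exact: neq_CB.
  have AC : {in A' & C, forall a b, a != b} by move=> a b aA bC; rewrite eq_sym neq_CA.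
  have AB : {in A' & B', forall a b, a != b} by exact: neq_AB.
  rewrite !prod_expn (prod_avail_rect uS sS CB) (prod_avail_rect uS sS AC).
  by rewrite (prod_avail_rect uS sS AB) (prod_avail_diag _ uS sS) sA sB.
have W0 : 0 < W.
  (* Zero weights are harmless, as 0 ^ 0 = 1. *)
  have self0 p : 0 < p ^ p by case: p => // p; rewrite expn_gt0.
  have selfX p e : 0 < (p ^ p) ^ e by rewrite expn_gt0 self0.
  by rewrite /W !muln_gt0 !selfX.
(* The chain is W Q^D <= D^D K^n <= D^D (weighted product) <= W S'^D; then W and the exponent D are
   cancelled. *)
apply: leq_trans S'E; rewrite leq_add2r -(leq_exp2r _ _ D0) -(leq_pmul2l W0).
apply: (leq_trans HQ); rewrite [W * _]mulnC; apply: leq_trans AG.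
exact: leq_mul.
Qed.
End LowerBound.

(** * Floating-point bounds *)

(* (x, e) denotes x * 2^e; products are rounded to 48-bit mantissas. *)
Definition flt := (N * N)%type.
Definition fval (f : flt) : N := (f.1 * 2 ^ f.2)%num.
Definition overflow (x : N) : N := (N.size x - 48)%num.
Definition fmul_dn (f g : flt) : flt :=
  let x := (f.1 * g.1)%num in let s := overflow x in
  (N.shiftr x s, f.2 + g.2 + s)%num.
(** One unit in the last place is added whenever bits are cut off, even if all of them are zero. *)
Definition fmul_up (f g : flt) : flt :=
  let x := (f.1 * g.1)%num in let s := overflow x in
  (N.shiftr x s + (if s is 0 then 0 else 1), f.2 + g.2 + s)%num.
Definition fpow (mul : flt -> flt -> flt) (f : flt) (n : nat) : flt :=
  if N.of_nat n is Npos p then Pos.iter_op mul p f else (1, 0)%num.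
Definition fnat (n : nat) : flt := (N.of_nat n, 0)%num.
Definition fle (f g : flt) : bool :=
  if N.leb g.2 f.2 then N.leb (f.1 * 2 ^ (f.2 - g.2)) g.1
  else N.leb f.1 (g.1 * 2 ^ (g.2 - f.2)).

Definition fbelow (f : flt) (x : nat) := (fval f <= N.of_nat x)%num.
Definition fabove (f : flt) (x : nat) := (N.of_nat x <= fval f)%num.

Lemma fbelow_mul f g x y : fbelow f x -> fbelow g y -> fbelow (fmul_dn f g) (x * y).
Proof.
rewrite /fbelow Nat2N.inj_mul => fx gy.
apply: N.le_trans (N.mul_le_mono _ _ _ _ fx gy).
rewrite /fval /fmul_dn /= N.shiftr_div_pow2 !N.pow_add_r.
set s := overflow _; set a := (f.1 * g.1)%num.
have := N.Div0.mul_div_le a (2 ^ s); rewrite /a => le.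
have := N.mul_le_mono_r _ _ (2 ^ f.2 * 2 ^ g.2) le; lia.
Qed.

Lemma fabove_mul f g x y : fabove f x -> fabove g y -> fabove (fmul_up f g) (x * y).
Proof.
rewrite /fabove Nat2N.inj_mul => fx gy.
apply: N.le_trans (N.mul_le_mono _ _ _ _ fx gy) _.
rewrite /fval /fmul_up /= N.shiftr_div_pow2 !N.pow_add_r.
set s := overflow _; set a := (f.1 * g.1)%num.
case: s => [|p]; first by rewrite !N.div_1_r; lia.
set s := N.pos p; have s0 : (2 ^ s <> 0)%num by apply: N.pow_nonzero.
have := N.mul_succ_div_gt a _ s0; rewrite /a -N.add_1_r => /N.lt_le_incl le.
have := N.mul_le_mono_r _ _ (2 ^ f.2 * 2 ^ g.2) le; lia.
Qed.

(** One induction for both rounding directions, following the repeated squaring in [fpow]. *)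
Lemma fpow_ind (R : flt -> nat -> Prop) mul f x n :
  (forall f g x y, R f x -> R g y -> R (mul f g) (x * y)) ->
  R (1, 0)%num 1 -> R f x -> R (fpow mul f n) (x ^ n).
Proof.
move=> Rmul R1; rewrite -{2}(Nat2N.id n) /fpow; case: (N.of_nat n) => //= p.
elim: p f x => [p IH|p IH|] f x Rf /=; last by rewrite expn1.
  by rewrite Pos2Nat.inj_xI multE expnS expnM; apply: (Rmul) => //; apply/IH/Rmul.
by rewrite Pos2Nat.inj_xO multE expnM; apply/IH/Rmul.
Qed.

Lemma fbelow_pow f x n : fbelow f x -> fbelow (fpow fmul_dn f n) (x ^ n).
Proof. by move=> fx; exact: (fpow_ind n fbelow_mul _ fx). Qed.

Lemma fabove_pow f x n : fabove f x -> fabove (fpow fmul_up f n) (x ^ n).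
Proof. by move=> fx; exact: (fpow_ind n fabove_mul _ fx). Qed.

Lemma fbelow_nat n : fbelow (fnat n) n.
Proof. by rewrite /fbelow /fval /=; lia. Qed.

Lemma fabove_nat n : fabove (fnat n) n.
Proof. by rewrite /fabove /fval /=; lia. Qed.

Lemma fleP f g : fle f g -> (fval f <= fval g)%num.
Proof.
rewrite /fle /fval; case: N.leb_spec => e /N.leb_le le.
  rewrite -{1}(N.sub_add _ _ e) N.pow_add_r; have := N.mul_le_mono_r _ _ (2 ^ g.2) le; lia.
rewrite -(N.sub_add f.2 g.2) ?N.pow_add_r; last by lia.
have := N.mul_le_mono_r _ _ (2 ^ f.2) le; lia.
Qed.

Lemma fle_leq f g x y : fle f g -> fabove f x -> fbelow g y -> x <= y.
Proof. by move=> /fleP; rewrite /fabove /fbelow; lia. Qed.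

Lemma of_nat_expn x n : N.of_nat (x ^ n) = (N.of_nat x ^ N.of_nat n)%num.
Proof.
by elim: n => // n IH; rewrite expnS Nat2N.inj_mul IH Nat2N.inj_succ N.pow_succ_r'.
Qed.

(** * Certificates *)

Definition frect_value m s t x y :=
  fmul_dn
    (fpow fmul_dn (fmul_dn (fpow fmul_dn (fnat (m - 2)) y)
                           (fpow fmul_dn (fnat (m - 1)) (t - y))) x)
    (fpow fmul_dn (fmul_dn (fpow fmul_dn (fnat (m - 1)) y)
                           (fpow fmul_dn (fnat m) (t - y))) (s - x)).

Definition flist_value m k l p0 p2 p3 x y z :=
  fmul_dn (fmul_dn (fmul_dn
    (fpow fmul_dn (fmul_dn (fpow fmul_dn (fnat (m - 1)) x)
                           (fpow fmul_dn (fnat m) (k - x))) p0)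
    (fpow fmul_dn (frect_value m k l x z) p2))
    (fpow fmul_dn (frect_value m l k y x) p2))
    (fpow fmul_dn (frect_value m l l y z) p3).

Lemma fbelow_list_value m k l p0 p2 p3 x y z :
  fbelow (flist_value m k l p0 p2 p3 x y z) (list_value m k l p0 p2 p3 x y z).
Proof.
by rewrite /flist_value /frect_value /list_value /rect_value;
  repeat (apply: fbelow_mul || apply: fbelow_pow || apply: fbelow_nat).
Qed.

(* [fle] is total; the default 0 saves proving it. *)
Definition fmin (f g : flt) : flt :=
  if fle f g then f else if fle g f then g else fnat 0.

Lemma fmin_fval f g : (fval (fmin f g) <= fval f)%num /\ (fval (fmin f g) <= fval g)%num.
Proof.
rewrite /fmin; case: ifP => [/fleP|_]; first by split=> //; exact: N.le_refl.
case: ifP => [/fleP|_]; first by split=> //; exact: N.le_refl.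
by split; exact: N.le_0_l.
Qed.

Lemma foldr_fmin_le (T : eqType) (F : T -> flt) f0 (s : seq T) x : x \in s ->
  (fval (foldr fmin f0 (map F s)) <= fval (F x))%num.
Proof.
elim: s => //= y s IH; rewrite inE => /orP[/eqP -> | /IH le].
  by case: (fmin_fval (F y) (foldr fmin f0 (map F s))).
by apply: N.le_trans le; case: (fmin_fval (F y) (foldr fmin f0 (map F s))).
Qed.

Definition triples m k l : seq (nat * nat * nat) :=
  [seq t <- [seq (xy, z) | xy <- [seq (x, y) | x <- iota 0 k.+1, y <- iota 0 l.+1],
                           z <- iota 0 l.+1] | t.1.1 + t.1.2 + t.2 <= m].

(** The starting value belongs to the triple (0, 0, 0), itself a candidate. *)
Definition min_list_value m k l p0 p2 p3 : flt :=
  foldr fmin (flist_value m k l p0 p2 p3 0 0 0)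
    [seq flist_value m k l p0 p2 p3 t.1.1 t.1.2 t.2 | t <- triples m k l].

(** The chromatic value minus k (k - 1) (m - 2)^n, the share covered by pairs of distinct common
    colors; computed exactly. *)
Definition target_num m k n : N :=
  (N.of_nat m * N.of_nat (m - 1) ^ N.of_nat n +
   N.of_nat (m * (m - 1) - k * (k - 1)) * N.of_nat (m - 2) ^ N.of_nat n)%num.

(** The numerical hypothesis of [ncol_ge_AGM], with the left side rounded up and the right side
    down. *)
Definition certified_at m k l p0 p2 p3 (D := k * p0 + k * l * p2 + l * k * p2 + l * l * p3)
    (K : flt) n : bool :=
  let self p e := fpow fmul_up (fpow fmul_up (fnat p) p) e in
  fle (fmul_up (fmul_up (fmul_up (fmul_up (self p0 k) (self p2 (k * l)))
                                 (self p2 (l * k))) (self p3 (l * l)))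
               (fpow fmul_up (target_num m k n, 0%num) D))
      (fmul_dn (fpow fmul_dn (fnat D) D) (fpow fmul_dn K n)).

(* Weights for [common] = k and all n in [first_n, last_n], found as rational
   approximations of the weights for which the AM-GM bound is best; a zero weight
   drops the pairs in question. *)
Record cert := Cert { first_n : nat; last_n : nat; common : nat;
                      w_diag : nat; w_mixed : nat; w_private : nat }.

(** The first condition makes the total weight D positive. K does not depend on n and serves the
    whole range. *)
Definition cert_ok m (c : cert) : bool :=
  let k := common c in let l := m - k in
  let K := min_list_value m k l (w_diag c) (w_mixed c) (w_private c) in
  (0 < k * w_diag c + l * l * w_private c) &&
  all (certified_at m k l (w_diag c) (w_mixed c) (w_private c) K)
      (iota (first_n c) (last_n c - first_n c).+1).

(** k runs over 0, ..., m - 2, since k = m - 1 and k = m have their own arguments; n runs over 2,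
    ..., N. *)
Definition covers m N (cs : seq cert) : bool :=
  all (fun k => all (fun n => has (fun c => (common c == k) && (first_n c <= n <= last_n c)) cs)
    (iota 2 (N - 1))) (iota 0 (m - 1)).

(** For k = 0 all pairs are private and get equal weights. Where a range of n is divided, the mixed
    pairs get a smaller share for the larger n. *)
Definition certs3 := [:: Cert 2 10 0 0 0 1; Cert 2 10 1 15 1 7].
Definition certs4 := [:: Cert 2 24 0 0 0 1; Cert 2 24 1 5 1 3;
  Cert 2 17 2 8 1 4; Cert 18 24 2 94 1 37].
Definition certs5 := [:: Cert 2 43 0 0 0 1; Cert 2 43 1 5 1 3;
  Cert 2 32 2 7 1 3; Cert 33 43 2 4 0 1; Cert 2 22 3 6 1 3; Cert 23 43 3 420 1 173].

Lemma min_list_value_le m k l p0 p2 p3 x y z :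
  x <= k -> y <= l -> z <= l -> x + y + z <= m ->
  N.to_nat (fval (min_list_value m k l p0 p2 p3)) <= list_value m k l p0 p2 p3 x y z.
Proof.
move=> xk yl zl xyz.
have mem_t : (x, y, z) \in triples m k l.
  rewrite mem_filter; apply/andP; split=> //; apply/allpairsP; exists ((x, y), z).
  rewrite mem_iota ltnS; split=> //.
  by apply/allpairsP; exists (x, y); rewrite !mem_iota !ltnS.
have := @foldr_fmin_le _ (fun t => flist_value m k l p0 p2 p3 t.1.1 t.1.2 t.2)
  (flist_value m k l p0 p2 p3 0 0 0) _ _ mem_t.
rewrite -/(min_list_value m k l p0 p2 p3) /=.
have := @fbelow_list_value m k l p0 p2 p3 x y z; rewrite /fbelow; lia.
Qed.

Lemma fabove_target_num m k n :
  fabove (target_num m k n, 0%num)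
    (m * (m - 1) ^ n + (m * (m - 1) - k * (k - 1)) * (m - 2) ^ n).
Proof.
rewrite /fabove /fval /= N.mul_1_r /target_num -!of_nat_expn.
rewrite -!Nat2N.inj_mul -Nat2N.inj_add; exact: N.le_refl.
Qed.

Lemma fabove_self p e :
  fabove (fpow fmul_up (fpow fmul_up (fnat p) p) e) ((p ^ p) ^ e).
Proof. exact/fabove_pow/fabove_pow/fabove_nat. Qed.

(** Rounding in the safe direction turns the check into the exact inequality that [ncol_ge_AGM] asks
    for. *)
Lemma ncol_ge_certified m n (C A' B' : seq nat) ls (c : cert) :
  uniq (C ++ A' ++ B') -> all uniq ls -> all (fun S => size S == m) ls ->
  size A' = m - size C -> size B' = m - size C -> size C <= m -> size ls = n ->
  cert_ok m c -> common c = size C -> first_n c <= n <= last_n c ->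
  m * (m - 1) ^ n + m * (m - 1) * (m - 2) ^ n <= ncol (C ++ A') (C ++ B') ls.
Proof.
move=> uCAB uls sls sA sB sC szls /andP[D0 /allP ok] ck /andP[nlo nhi].
have : n \in iota (first_n c) (last_n c - first_n c).+1 by rewrite mem_iota; lia.
move=> /ok; rewrite ck; set K := min_list_value _ _ _ _ _ _.
set l := m - size C => fok.
have kk : size C * (size C - 1) <= m * (m - 1) by rewrite leq_mul // leq_sub2r.
(* The part k (k - 1) (m - 2)^n is split off, as [ncol_ge_AGM] adds it separately. *)
rewrite -(subnK kk) mulnDl addnA -szls.
apply: (@ncol_ge_AGM m C A' B' ls uCAB uls sls l (w_diag c) (w_mixed c) (w_private c)
  (N.to_nat (fval K))) => //.
- by move: D0; rewrite ck -/l; lia.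
- by move=> x y z xk yl zl xyz; exact: min_list_value_le.
rewrite szls; apply: (fle_leq fok).
  apply: fabove_mul; last exact/fabove_pow/fabove_target_num.
  by do 3 (apply: fabove_mul; last exact: fabove_self); exact: fabove_self.
apply: fbelow_mul; apply: fbelow_pow; first exact: fbelow_nat.
by rewrite /fbelow N2Nat.id; exact: N.le_refl.
Qed.

(** By the number of common colors: certificates up to m - 2, Bernoulli for m - 1, termwise
    comparison for m. *)
Lemma list_color_fun_certified m N cs : 1 < m -> all (cert_ok m) cs -> covers m N cs ->
  forall n, 2 <= n <= N -> list_color_fun (Kpq 2 n) m = chrom_poly (Kpq 2 n) m.
Proof.
move=> m1 ok /allP cov n /andP[n2 nN].
apply: list_color_fun_eq => A B ls uA uB uls sA sB sls szls.
have [C [A' [B' [uCAB pA pB szA szB]]]] := split_common uA uB sA sB.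
have sC : size C <= m by rewrite -sA (perm_size pA) size_cat leq_addr.
rewrite (perm_ncol _ pA pB).
have [kle|kgt] := ltnP (size C) (m - 1).
  have /cov/allP/(_ n) : size C \in iota 0 (m - 1) by rewrite mem_iota.
  rewrite mem_iota => /(_ _)/(has_nthP (Cert 0 0 0 0 0 0))[|i ics /andP[/eqP ck cn]].
    by lia.
  have cok := all_nthP (Cert 0 0 0 0 0 0) ok i ics.
  exact: (ncol_ge_certified uCAB uls sls szA szB sC szls cok ck cn).
have [eC|neC] := eqVneq (size C) m; first by rewrite -szls; exact: ncol_ge_same.
have eC : size C = m - 1 by lia.
have sA1 : size A' = 1 by rewrite szA eC subKn // ltnW.
have sB1 : size B' = 1 by rewrite szB -szA.
case: A' sA1 {szA pA} uCAB => [|a0 [|? ?]] // _; case: B' sB1 {szB pB} => [|b0 [|? ?]] // _ uCAB.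
by rewrite -szls; apply: (@ncol_ge_pred m C [:: a0] [:: b0] ls uCAB uls sls a0 b0).
Qed.

(** * Assignments with few colorings *)

(** Binary arithmetic makes the counts of explicit assignments computable. *)
Fixpoint ext_num (ls : seq (seq nat)) a b : N :=
  if ls is T :: ls' then (N.of_nat (avail a b T) * ext_num ls' a b)%num else 1%num.
Definition ncol_num (A B : seq nat) ls : N :=
  foldr (fun a t => foldr (fun b u => ext_num ls a b + u)%num 0%num B + t)%num 0%num A.

Lemma ncol_numE A B ls : ncol_num A B ls = N.of_nat (ncol A B ls).
Proof.
have extE a b : ext_num ls a b = N.of_nat (ext ls a b).
  elim: ls => [|S ls IH] /=; first by rewrite /ext big_nil.
  by rewrite /ext big_cons Nat2N.inj_mul IH.
rewrite /ncol /ncol_num; elim: A => [|a A IH]; first by rewrite big_nil.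
rewrite big_cons Nat2N.inj_add -IH /=; congr (_ + _)%num.
elim: B {IH} => [|b B IH]; first by rewrite big_nil.
by rewrite big_cons Nat2N.inj_add -IH /= extE.
Qed.

(** A vertex with list A always loses the color a in A of its neighbor, which leaves at most m - 1
    choices. *)
Lemma ncol_pad m (A B : seq nat) ls j : uniq A -> size A = m ->
  ncol A B (nseq j A ++ ls) <= (m - 1) ^ j * ncol A B ls.
Proof.
move=> uA sA; elim: j => [|j IH]; first by rewrite mul1n.
rewrite expnS -mulnA; apply: leq_trans (leq_mul (leqnn _) IH).
rewrite /ncol big_distrr big_seq [X in _ <= X]big_seq /=; apply: leq_sum => a aA.
rewrite big_distrr; apply: leq_sum => b _.
rewrite /ext big_cons leq_mul2r; apply/orP; right.
have [<-|ab] := eqVneq a b; first by rewrite avail_eq // sA aA.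
by rewrite avail_neq // sA aA leq_subr.
Qed.

(** This is B, opposite A = [iota 0 m]: the common colors are 0, ..., m - 3, the private ones m - 2,
    m - 1 for A and m, m + 1 for B. The quadruple counts the lists for each choice of one private
    color from either side. *)
Definition bad_side m := iota 0 (m - 2) ++ [:: m; m.+1].
Definition bad_list m a b := iota 0 (m - 2) ++ [:: a; b].
Definition bad_lists m (q : nat * nat * nat * nat) :=
  let: (q1, q2, q3, q4) := q in
  nseq q1 (bad_list m (m - 2) m) ++ nseq q2 (bad_list m (m - 2) m.+1) ++
  nseq q3 (bad_list m (m - 1) m) ++ nseq q4 (bad_list m (m - 1) m.+1).

(** The bound m (m - 1)^n survives padding by lists A. The chromatic value exceeds it by m (m - 1)
    (m - 2)^n, which is positive as m > 2. *)
Lemma list_color_fun_bad m q n : 2 < m ->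
  uniq (bad_side m) -> all uniq (bad_lists m q) -> size (bad_side m) = m ->
  all (fun S => size S == m) (bad_lists m q) ->
  N.leb (ncol_num (iota 0 m) (bad_side m) (bad_lists m q))
    (N.of_nat m * N.of_nat (m - 1) ^ N.of_nat (size (bad_lists m q)))%num ->
  size (bad_lists m q) <= n ->
  list_color_fun (Kpq 2 n) m < chrom_poly (Kpq 2 n) m.
Proof.
set ls := bad_lists m q => m2 uB uls sB sls /N.leb_le.
rewrite ncol_numE -of_nat_expn -Nat2N.inj_mul => le0 szn.
have {}le0 : ncol (iota 0 m) (bad_side m) ls <= m * (m - 1) ^ size ls by lia.
have uA := iota_uniq 0 m; have sA := size_iota 0 m.
apply: (@list_color_fun_lt _ _ (iota 0 m) (bad_side m) (nseq (n - size ls) (iota 0 m) ++ ls)) => //.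
- by rewrite all_cat all_nseq uA orbT.
- by rewrite all_cat all_nseq sA eqxx orbT.
- by rewrite size_cat size_nseq subnK.
apply: leq_ltn_trans (ncol_pad _ _ _ uA sA) _.
apply: leq_ltn_trans (leq_mul (leqnn _) le0) _.
rewrite mulnCA -expnD subnK // chrom_poly_Kpq2 -[X in X < _]addn0 ltn_add2l.
by rewrite !muln_gt0 expn_gt0; lia.
Qed.

Theorem theorem7 :
  ((forall n : nat, 2 <= n <= 10 ->
      list_color_fun (Kpq 2 n) 3 = chrom_poly (Kpq 2 n) 3) /\
   (forall n : nat, 12 <= n ->
      list_color_fun (Kpq 2 n) 3 < chrom_poly (Kpq 2 n) 3)) /\
  ((forall n : nat, 2 <= n <= 24 ->
      list_color_fun (Kpq 2 n) 4 = chrom_poly (Kpq 2 n) 4) /\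
   (forall n : nat, 27 <= n ->
      list_color_fun (Kpq 2 n) 4 < chrom_poly (Kpq 2 n) 4)) /\
  ((forall n : nat, 2 <= n <= 43 ->
      list_color_fun (Kpq 2 n) 5 = chrom_poly (Kpq 2 n) 5) /\
   (forall n : nat, 44 <= n ->
      list_color_fun (Kpq 2 n) 5 < chrom_poly (Kpq 2 n) 5)).
Proof.
split; last split; split.
- by apply: (@list_color_fun_certified 3 10 certs3); vm_compute.
(* Here and below the quadruple sums to the least n claimed (12, 27, 44) and is as even as
   possible. *)
- by move=> n n12; apply: (@list_color_fun_bad 3 (3, 3, 3, 3)) => //; vm_compute.
- by apply: (@list_color_fun_certified 4 24 certs4); vm_compute.
- by move=> n n27; apply: (@list_color_fun_bad 4 (7, 7, 7, 6)) => //; vm_compute.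
- by apply: (@list_color_fun_certified 5 43 certs5); vm_compute.
- by move=> n n44; apply: (@list_color_fun_bad 5 (11, 11, 11, 11)) => //; vm_compute.
Qed.
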